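(* Let $\mathbf w$ be a probability vector, $\bar{\mathbf p}=(\bar p_1,\ldots,\bar p_L)^\top>\mathbf 0$, and let $\mathbf p^\star=(p_1^\star,\ldots,p_L^\star)^\top$ be a maximal solution to the problem $$\max_{\mathbf 0\le\mathbf p\le\bar{\mathbf p}}\ \sum_{l=1}^L w_l\log(1+\gamma_l(\mathbf p)).$$ Divide $\{1,\ldots,L\}$ into the three disjoint sets $$S_{\max}=\{i:\ p_i^\star=\bar p_i\},\qquad S_{\mathrm{in}}=\{i:\ p_i^\star\in(0,\bar p_i)\},\qquad S_0=\{i:\ p_i^\star=0\}.$$ Then $$\left(H(\mathbf p^\star)^\top\nabla\Phi_{\mathbf w}(\gamma(\mathbf p^\star))\right)_i\ge 0\ \text{ for } i\in S_{\max},$$ $$\left(H(\mathbf p^\star)^\top\nabla\Phi_{\mathbf w}(\gamma(\mathbf p^\star))\right)_i= 0\ \text{ for } i\in S_{\mathrm{in}},$$ $$\left(H(\mathbf p^\star)^\top\nabla\Phi_{\mathbf w}(\gamma(\mathbf p^\star))\right)_i\le 0\ \text{ for } i\in S_0.$$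
   Context: $F=[f_{ij}]\in\mathbb R^{L\times L}$ is a fixed matrix with zero diagonal entries and positive off-diagonal entries, and $\mathbf v=(v_1,\ldots,v_L)^\top$ is a fixed vector with all entries positive. The map $\gamma:\mathbb R_+^L\to\mathbb R_+^L$ is $\gamma_l(\mathbf p)=\dfrac{p_l}{(F\mathbf p)_l+v_l}$. For $\mathbf p\ge\mathbf 0$, $H(\mathbf p)=\left[\frac{\partial\gamma_i}{\partial p_j}\right]_{i,j=1}^L=\mathrm{diag}\left((F\mathbf p+\mathbf v)^{-1}\right)\left(I-\mathrm{diag}(\gamma(\mathbf p))F\right)$, where the inverse of a positive vector is taken entrywise. $\Phi_{\mathbf w}(\boldsymbol\gamma)=\sum_{i=1}^L w_i\log(1+\gamma_i)$, whose gradient with respect to $\boldsymbol\gamma$ is $\nabla\Phi_{\mathbf w}(\boldsymbol\gamma)=\left(\frac{w_1}{1+\gamma_1},\ldots,\frac{w_L}{1+\gamma_L}\right)^\top$. Vector inequalities are entrywise; $\mathrm{diag}(\mathbf y)$ is the diagonal matrix with diagonal $\mathbf y$; a probability vector is a nonnegative vector with entries summing to $1$. *)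

(* Defs.v *)
From HB Require Import structures.
From mathcomp Require Import all_boot all_order all_algebra.
From mathcomp Require Import all_classical all_reals all_analysis.
From mathcomp Require Import ring.
Import Order.TTheory GRing.Theory Num.Theory.
Import numFieldNormedType.Exports.
Set Implicit Arguments.
Unset Strict Implicit.
Unset Printing Implicit Defensive.

Local Open Scope ring_scope.

Section Definitions.
Context {R : realType} {L : nat}.
Implicit Types (F : 'M[R]_L) (v w p pbar g : 'cV[R]_L) (i j l : 'I_L).

Definition prob_vector w : Prop :=
  (forall i, 0 <= w i 0) /\ \sum_i w i 0 = 1.

Definition gamma F v p : 'cV[R]_L := \col_l (p l 0 / ((F *m p) l 0 + v l 0)).

Definition Phi w g : R := \sum_i w i 0 * ln (1 + g i 0).

Definition partial j (f : 'cV[R]_L -> R) p : R := 'D_(delta_mx j 0) f p.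

Definition grad (f : 'cV[R]_L -> R) p : 'cV[R]_L := \col_j partial j f p.

(* [gamma F v] is a total formula, smooth around every [p >= 0] when [F >= 0] and
   [v > 0]; the partial derivatives are two-sided also on the boundary of the
   nonnegative orthant, where they agree with the closed form [HE] below. *)
Definition H F v p : 'M[R]_L :=
  \matrix_(i, j) partial j (fun q => gamma F v q i 0) p.

Definition feasible pbar p : Prop := forall i, 0 <= p i 0 <= pbar i 0.

Definition maximal_solution F v w pbar p : Prop :=
  feasible pbar p /\
  forall q, feasible pbar q -> Phi w (gamma F v q) <= Phi w (gamma F v p).

Definition Smax pbar p : {set 'I_L} := [set i | p i 0 == pbar i 0].
Definition Sin pbar p : {set 'I_L} := [set i | 0 < p i 0 < pbar i 0].
Definition Szero p : {set 'I_L} := [set i | p i 0 == 0].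

Lemma partialE j (f : 'cV[R]_L -> R) p :
  partial j f p = 'D_1 (fun t : R => f (t *: delta_mx j 0 + p)) 0.
Proof.
rewrite /partial /derive; set d := (X in fmap X).
set d' := (X in _ = lim (fmap X _)).
suff -> : d = d' by [].
apply/funext => h; rewrite /d /d' /= addr0 scale0r add0r.
by rewrite [h *: 1](mulr1 h).
Qed.

Lemma is_derive_affine (a b x : R) : is_derive x 1 (fun t : R => t * a + b) a.
Proof.
pose P := ('X * a%:P + b%:P)%R.
have -> : (fun t : R => t * a + b) = horner P.
  by apply/funext => t; rewrite /P !hornerE.
apply: is_derive_eq (is_derive_poly P x) _.
by rewrite /P derivD derivM derivX !derivC !hornerE.
Qed.

Lemma HE F v p : (forall i j, i != j -> 0 < F i j) -> (forall i, F i i = 0) ->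
  (forall i, 0 < v i 0) -> (forall i, 0 <= p i 0) ->
  H F v p = diag_mx (\row_i ((F *m p) i 0 + v i 0)^-1)
            *m (1%:M - diag_mx (gamma F v p)^T *m F).
Proof.
move=> Fo Fd v0 p0; apply/matrixP => i j.
rewrite !mul_diag_mx !mxE partialE.
set a := (i == j)%:R : R.
set d := (\sum_(k < L) F i k * p k 0 + v i 0).
have d0 : 0 < d.
  rewrite ltr_wpDl// sumr_ge0// => k _; rewrite mulr_ge0//.
  by have [->|ik] := eqVneq i k; [rewrite Fd|exact/ltW/Fo].
have -> : (fun t : R => gamma F v (t *: delta_mx j 0 + p) i 0) =
    (fun t => t * a + p i 0) * (fun t => (t * F i j + d)^-1).
  apply/funext => t; rewrite mxE; congr (_ * _^-1).
    by rewrite !mxE eqxx andbT.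
  rewrite /d addrA; congr (_ + v i 0).
  by rewrite mulmxDr -scalemxAr -colE !mxE.
have d1 : is_derive (0 : R) 1 (fun t : R => t * a + p i 0) a.
  exact: is_derive_affine.
have d2 : is_derive (0 : R) 1 (fun t : R => t * F i j + d) (F i j).
  exact: is_derive_affine.
have d2d : (fun t : R => t * F i j + d) 0 != 0 by rewrite mul0r add0r gt_eqF.
have d3 : is_derive (0 : R) 1 (fun t : R => (t * F i j + d)^-1) (- d ^- 2 * F i j).
  by have := @is_deriveV _ (fun t => t * F i j + d) _ _ _ d2d d2;
    rewrite /= mul0r add0r.
rewrite derive_val /GRing.scale /= !mul0r !add0r.
by field; rewrite gt_eqF.
Qed.

Lemma grad_PhiE w g : (forall i, 0 <= g i 0) ->
  grad (Phi w) g = \col_i (w i 0 / (1 + g i 0)).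
Proof.
move=> g0; apply/matrixP => j k; rewrite {k}ord1 !mxE partialE.
have -> : (fun t : R => Phi w (t *: delta_mx j 0 + g)) =
   \sum_(i < L) (fun t : R => w i 0 * ln (t * (i == j)%:R + (1 + g i 0))).
  apply/funext => t; rewrite fct_sumE; apply: eq_bigr => i _.
  by rewrite !mxE eqxx andbT addrCA.
have Hd i : is_derive (0 : R) 1
   (fun t : R => w i 0 * ln (t * (i == j)%:R + (1 + g i 0)))
   (w i 0 * ((i == j)%:R / (1 + g i 0))).
  have pos : 0 < 1 + g i 0 by rewrite ltr_pwDl.
  have d1 := is_derive_affine (i == j)%:R (1 + g i 0) 0.
  have d2 : is_derive (0 * (i == j)%:R + (1 + g i 0)) 1 (@ln R) (1 + g i 0)^-1.
    by rewrite mul0r add0r; exact: is_derive1_ln.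
  have d3 := @is_derive1_comp _ _
    (fun t => t * (i == j)%:R + (1 + g i 0)) _ _ _ d2 d1.
  have d4 := is_deriveZ (w i 0) d3.
  by apply: is_derive_eq d4 _; rewrite /GRing.scale /= (mulrC (_ == _)%:R).
rewrite derive_val (bigD1 j)//= eqxx big1 ?addr0 ?mul1r// => i ij.
by rewrite (negbTE ij) mul0r mulr0.
Qed.

End Definitions.

(* Main.v *)
Require Import Defs.
From HB Require Import structures.
From mathcomp Require Import all_boot all_order all_algebra.
From mathcomp Require Import all_classical all_reals all_analysis.
Import Order.TTheory GRing.Theory Num.Theory.
Import numFieldNormedType.Exports.
Local Open Scope ring_scope.

(** These are the first-order necessary conditions for maximising a
differentiable function over a box.  By the chain rule the [i]-th entry of
[H(p)^T grad Phi(gamma(p))] is the derivative at [t = 0] of the objective along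
the coordinate line [t |-> t e_i + p] ([is_derive_objective]).  If [p] is a
maximiser and [p_i < pbar_i], small positive [t] stay in the box, so the
objective cannot exceed its value at [t = 0] there and the derivative is
nonpositive ([directional_le0]).  If [0 < p_i], the same holds for small
negative [t] and the derivative is nonnegative ([directional_ge0]).  On [Smax]
and [Szero] one of the two moves is available because [pbar] is positive, and on
[Sin] both are. *)

(** Only the right difference quotients matter: they are all nonpositive, and
they converge to the derivative. *)
Lemma is_derive_le0_right_max (R : realType) (f : R -> R) (x l e : R) :
  0 < e -> is_derive x 1 f l -> (forall t, 0 < t < e -> f (t + x) <= f x) ->
  l <= 0.
Proof.
move=> e0 [df <-] fmax.
have cf : (h^-1 *: (f (h + x) - f x) @[h --> 0^'+] --> 'D_1 f x)%classic.
  have /cvg_dnbhs_at_right := df; rewrite /derive => cf.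
  by under eq_fun do rewrite -[X in f (X + x)]mulr1.
rewrite -(cvg_lim _ cf)//; apply: limr_le; first by apply/cvg_ex; exists ('D_1 f x).
near=> h; have h0 : 0 < h by [].
rewrite /GRing.scale/= pmulr_rle0 ?invr_gt0// subr_le0 fmax// h0/=.
by near: h; exact: nbhs_right_lt.
Unshelve. all: by end_near. Qed.

(** The reflection [t |-> - t] exchanges the two sides and the sign of the
derivative. *)
Lemma is_derive_ge0_left_max (R : realType) (f : R -> R) (x l e : R) :
  0 < e -> is_derive x 1 f l -> (forall t, 0 < t < e -> f (x - t) <= f x) ->
  0 <= l.
Proof.
move=> e0 df fmax; rewrite -oppr_le0.
have dN : is_derive (- x) 1 (fun t : R => - t) (- 1) by exact: is_deriveN.
have df' : is_derive (- - x) 1 f l by rewrite opprK.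
have := @is_derive1_comp _ f (fun t => - t) _ _ _ df' dN.
rewrite mulrN1 => /(is_derive_le0_right_max _ _ _ _ _ e0); apply => t te /=.
by rewrite opprD opprK addrC fmax.
Qed.

Section CoordinateLine.
Context {R : realType} {L : nat}.
Variables (F : 'M[R]_L) (v p : 'cV[R]_L).
Hypothesis F_ge0 : forall i j, 0 <= F i j.
Hypothesis v_gt0 : forall i, 0 < v i 0.
Hypothesis p_ge0 : forall i, 0 <= p i 0.

Let denom_gt0 i : 0 < (F *m p) i 0 + v i 0.
Proof. by rewrite ltr_wpDl// mxE sumr_ge0// => k _; rewrite mulr_ge0. Qed.

Let gamma_ge0 i : 0 <= gamma F v p i 0.
Proof. by rewrite mxE divr_ge0// ltW. Qed.

(** [H] is defined through a total derivative operator, so its entries are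
derivatives only once the quotient of affine functions is shown derivable. *)
Lemma is_derive_gamma i j :
  is_derive (0 : R) 1 (fun t : R => gamma F v (t *: delta_mx j 0 + p) i 0)
    (H F v p i j).
Proof.
rewrite [H _ _ _ _ _]mxE partialE; apply: derivableP.
have -> : (fun t : R => gamma F v (t *: delta_mx j 0 + p) i 0) =
    (fun t => t * (i == j)%:R + p i 0) *
    (fun t => (t * F i j + ((F *m p) i 0 + v i 0))^-1).
  apply/funext => t; rewrite mxE; congr (_ * _^-1).
    by rewrite !mxE eqxx andbT.
  rewrite addrA; congr (_ + v i 0).
  by rewrite mulmxDr -scalemxAr -colE !mxE.
have [d1 _] := is_derive_affine (i == j)%:R (p i 0) 0.
have [d2 _] := is_derive_affine (F i j) ((F *m p) i 0 + v i 0) 0.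
apply: derivableM => //; apply: derivableV => //.
by rewrite mul0r add0r gt_eqF.
Qed.

(** The chain rule through each summand [w_i log (1 + gamma_i)]. *)
Lemma is_derive_objective w j :
  is_derive (0 : R) 1 (fun t : R => Phi w (gamma F v (t *: delta_mx j 0 + p)))
    (((H F v p)^T *m grad (Phi w) (gamma F v p)) j 0).
Proof.
have -> : (fun t : R => Phi w (gamma F v (t *: delta_mx j 0 + p))) =
    \sum_(i < L)
      (fun t : R => w i 0 * ln (1 + gamma F v (t *: delta_mx j 0 + p) i 0)).
  by apply/funext => t; rewrite fct_sumE.
rewrite grad_PhiE// mxE; apply: is_derive_sum => i.
have dg := is_derive_gamma i j.
have d1 : is_derive (0 : R) 1
    (fun t : R => 1 + gamma F v (t *: delta_mx j 0 + p) i 0) (H F v p i j).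
  by have := is_deriveD (is_derive_cst (1 : R) (0 : R) 1) dg; rewrite add0r.
have d2 : is_derive (1 + gamma F v (0 *: delta_mx j 0 + p) i 0) 1 (@ln R)
    (1 + gamma F v p i 0)^-1.
  by rewrite scale0r add0r; apply: is_derive1_ln; rewrite ltr_pwDl.
have d3 := @is_derive1_comp _ _
  (fun t => 1 + gamma F v (t *: delta_mx j 0 + p) i 0) _ _ _ d2 d1.
apply: is_derive_eq (is_deriveZ (w i 0) d3) _.
rewrite /GRing.scale /= [_^T _ _]mxE [(\col__ _) _ _]mxE.
by rewrite [LHS]mulrA mulrC.
Qed.

End CoordinateLine.

Section FirstOrder.
Context {R : realType} {L : nat}.
Variables (F : 'M[R]_L) (v w pbar p : 'cV[R]_L).
Hypothesis F_ge0 : forall i j, 0 <= F i j.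
Hypothesis v_gt0 : forall i, 0 < v i 0.
Hypothesis p_max : maximal_solution F v w pbar p.

Let p_ge0 i : 0 <= p i 0.
Proof. by have [/(_ i)/andP[]] := p_max. Qed.

(* The moved point differs from [p] in the entry [j] alone, so only that entry
   can leave the box. *)
Let objective_le j (t : R) : 0 <= t + p j 0 <= pbar j 0 ->
  Phi w (gamma F v (t *: delta_mx j 0 + p)) <= Phi w (gamma F v p).
Proof.
move=> tp; have [pf pm] := p_max; apply: pm => i; rewrite !mxE eqxx andbT.
by have [->|_] := eqVneq i j; rewrite (mulr1, mulr0) ?add0r.
Qed.

Lemma directional_le0 j : p j 0 < pbar j 0 ->
  ((H F v p)^T *m grad (Phi w) (gamma F v p)) j 0 <= 0.
Proof.
rewrite -subr_gt0 => pj.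
apply: is_derive_le0_right_max pj (is_derive_objective F v p F_ge0 v_gt0 p_ge0 w j) _.
move=> t /andP[t0 tp]; rewrite addr0 scale0r add0r objective_le//.
by rewrite addr_ge0 ?(ltW t0)//= -lerBrDr ltW.
Qed.

Lemma directional_ge0 j : 0 < p j 0 ->
  0 <= ((H F v p)^T *m grad (Phi w) (gamma F v p)) j 0.
Proof.
move=> pj.
apply: is_derive_ge0_left_max pj (is_derive_objective F v p F_ge0 v_gt0 p_ge0 w j) _.
move=> t /andP[t0 tp]; rewrite add0r scale0r add0r objective_le// addrC subr_ge0 ltW//=.
have [/(_ j)/andP[_ pb] _] := p_max.
by rewrite (le_trans _ pb)// gerBl ltW.
Qed.

End FirstOrder.

Theorem corollary3p4 (R : realType) (L : nat)
  (F : 'M[R]_L) (v w pbar pstar : 'cV[R]_L)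
  (F_diag : forall i, F i i = 0)
  (F_offdiag : forall i j, i != j -> 0 < F i j)
  (v_gt0 : forall i, 0 < v i 0)
  (w_prob : prob_vector w)
  (pbar_gt0 : forall i, 0 < pbar i 0)
  (pstar_max : maximal_solution F v w pbar pstar) :
  let D := (H F v pstar)^T *m grad (Phi w) (gamma F v pstar) in
  [/\ forall i, i \in Smax pbar pstar -> 0 <= D i 0,
      forall i, i \in Sin pbar pstar -> D i 0 = 0
    & forall i, i \in Szero pstar -> D i 0 <= 0].
Proof.
move=> D.
have F_ge0 i j : 0 <= F i j.
  by have [->|/F_offdiag/ltW//] := eqVneq i j; rewrite F_diag.
have Dle := directional_le0 F v w pbar pstar F_ge0 v_gt0 pstar_max.
have Dge := directional_ge0 F v w pbar pstar F_ge0 v_gt0 pstar_max.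
split=> i; rewrite inE.
- by move=> /eqP pi; apply: Dge; rewrite pi.
- by move=> /andP[p0 pb]; apply/eqP; rewrite eq_le Dle ?Dge.
- by move=> /eqP pi; apply: Dle; rewrite pi.
Qed.
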